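(* Let $L$ be an infinite-dimensional separable complex Hilbert space with a conjugation, and let $\mathcal F$ be the fermionic Fock space over $L$ with number operator $N$. Let $A\in B_2^-(L)$, let $1\le r\le 2$, $s=\frac{2(r-1)}{r}$, and suppose there are real constants $\gamma_r,\delta_r$ such that, on the finite-particle subspace $\mathcal F_0$, $$ \Delta(A)^*\Delta(A)\le\gamma_r N^s+\delta_r\mathbb 1 . $$ Then $A\in B_{r+\varepsilon}^-(L)$ for all $\varepsilon>0$.
   Context: Inner products are antilinear in the first and linear in the second argument. $L$ is a separable complex Hilbert space with a conjugation $f\mapsto\bar f$ (antilinear isometric involution). Fock representation of the CAR over $L$: $\mathcal F$ is a complex Hilbert space and $f\mapsto a(f)$, $f\mapsto a^\dagger(f)$ are linear maps from $L$ into the bounded operators on $\mathcal F$ with $\{a(f),a(g)\}=0=\{a^\dagger(f),a^\dagger(g)\}$, $\{a(f),a^\dagger(g)\}=(\bar f,g)\mathbb 1$ (anticommutators), $a(f)^*=a^\dagger(\bar f)$, together with a unit vector $\Omega\in\mathcal F$ (vacuum) such that $a(f)\Omega=0$ for all $f\in L$ and the vectors $a^\dagger(f_n)\cdots a^\dagger(f_1)\Omega$ ($n\ge 0$, $f_i\in L$) span a dense subspace of $\mathcal F$. The $n$-particle space $\mathcal F^{(n)}$ is the closed span of the vectors $a^\dagger(f_n)\cdots a^\dagger(f_1)\Omega$; $\mathcal F$ is the orthogonal sum of the $\mathcal F^{(n)}$, $n\ge0$. $\mathcal F_0$ is the linear span of $\bigcup_n\mathcal F^{(n)}$. The transpose of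 a bounded operator $A$ on $L$ is $A^T:=\bar A^*$, where $\bar A f:=\overline{A\bar f}$. $B_r(L)$, $1\le r<\infty$, is the $r$-th von Neumann-Schatten class on $L$ (compact operators with $\sum_j\mu_j^r<\infty$, $\mu_j$ the singular values), and $B_r^-(L)$ is the set of $A\in B_r(L)$ with $A^T=-A$. For $A\in B_2^-(L)$, $\Delta(A):=\sum_j a(Ae_j)a(\bar e_j)$ on $\mathcal F_0$, where $\{e_j\}$ is a complete orthonormal system in $L$ (well-defined on $\mathcal F_0$; maps $\mathcal F^{(n)}$ into $\mathcal F^{(n-2)}$). The number operator is $N:=\sum_j a^\dagger(e_j)a(\bar e_j)$; $N\Phi=n\Phi$ and $N^s\Phi=n^s\Phi$ for $\Phi\in\mathcal F^{(n)}$, with $N^0=\mathbb 1$. Operator inequalities $X\le Y$ are meant as $(\Phi,X\Phi)\le(\Phi,Y\Phi)$ for all $\Phi\in\mathcal F_0$, with $(\Phi,T^*T\Phi)=\|T\Phi\|^2$. *)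

(* Defs.v *)
From HB Require Import structures.
From mathcomp Require Import all_boot all_order all_algebra complex.
From mathcomp Require Import all_classical all_reals all_analysis.

Set Implicit Arguments.
Unset Strict Implicit.
Unset Printing Implicit Defensive.

Import Order.TTheory GRing.Theory Num.Theory.
Import numFieldNormedType.Exports.

Local Open Scope classical_set_scope.
Local Open Scope ring_scope.
Local Open Scope complex_scope.

(* A positive definite form of sesquilinear.v is linear in its first argument;
   [inner] below reverses the arguments. *)
HB.mixin Record isHilbert (R : realType) V
    of CompleteNormedModule R[i] V := {
  hdot : {dot V for @Num.conj R[i]} ;
  hdot_norm : forall u : V, hdot u u = `|u| ^+ 2 }.

#[short(type="hilbertType")]
HB.structure Definition Hilbert (R : realType) :=
  { V of isHilbert R V & CompleteNormedModule R[i] V }.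

Definition inner (R : realType) (L : hilbertType R) (f g : L) : R[i] :=
  hdot g f.

Section LinearSpan.
Variables (K : fieldType) (V : lmodType K).

Definition lspan (S : set V) : set V :=
  [set v | exists n (c : 'I_n -> K) (x : 'I_n -> V),
     (forall i, S (x i)) /\ v = \sum_(i < n) c i *: x i].

Definition lin_indep n (v : 'I_n -> V) : Prop :=
  forall c : 'I_n -> K, \sum_(i < n) c i *: v i = 0 -> forall i, c i = 0.

Definition vdim (R : realType) (E : set V) : \bar R :=
  ereal_sup [set n%:R%:E | n in
    [set n | exists2 v : 'I_n -> V, lin_indep v & forall i, E (v i)]].

End LinearSpan.

Section HilbertSpace.
Variables (R : realType) (L : hilbertType R).

Definition separable_space : Prop := exists2 D : set L, countable D & dense D.

Definition infinite_dimensional : Prop := vdim R [set: L] = +oo%E.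

Definition complete_orthonormal (e : nat -> L) : Prop :=
  (forall i j, inner (e i) (e j) = (i == j)%:R) /\ dense (lspan (range e)).

Definition conjugation (J : L -> L) : Prop :=
  [/\ forall (c : R[i]) f g, J (c *: f + g) = c^* *: J f + J g,
      forall f, `|J f| = `|f| &
      involutive J].

Definition is_adjoint (A B : L -> L) : Prop :=
  forall f g, inner (B f) g = inner f (A g).

Definition is_transpose (J : L -> L) (A B : L -> L) : Prop :=
  is_adjoint (fun f => J (A (J f))) B.

Definition compact_operator (A : L -> L) : Prop :=
  precompact (A @` [set f | `|f| <= 1]).

(* For l > 0, the multiplicity of l as an eigenvalue of |A|, that is of l^2 as
   an eigenvalue of A^* A; the second argument is A^*. *)
Definition singular_mult (A As : L -> L) (l : R) : \bar R :=
  vdim R [set f | As (A f) = (l ^+ 2)%:C *: f].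

(* The sum over the nonzero singular values, each counted with its
   multiplicity, of their r-th powers. *)
Definition schatten (r : R) (A : {linear L -> L}) : Prop :=
  compact_operator A /\
  exists2 As : L -> L, is_adjoint A As &
    (\esum_(l in [set l : R | (0 < l)%R])
        (singular_mult A As l * (l `^ r)%:E) < +oo)%E.

Definition schatten_skew (J : L -> L) (r : R) (A : {linear L -> L}) : Prop :=
  schatten r A /\ is_transpose J A (fun f => - A f).

End HilbertSpace.

Section Fock.
Variables (R : realType) (L : hilbertType R) (J : L -> L) (F : hilbertType R).

(* [foldr cre vac s] is the vector a^+(f_n) ... a^+(f_1) Omega for
   s = [:: f_n; ...; f_1]. *)
Record fock_rep := FockRep {
  ann : L -> {linear F -> F} ;
  cre : L -> {linear F -> F} ;
  vac : F ;
  ann_bounded : forall f, continuous (ann f) ;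
  cre_bounded : forall f, continuous (cre f) ;
  ann_linear : forall (c : R[i]) f g Phi,
    ann (c *: f + g) Phi = c *: ann f Phi + ann g Phi ;
  cre_linear : forall (c : R[i]) f g Phi,
    cre (c *: f + g) Phi = c *: cre f Phi + cre g Phi ;
  car_ann : forall f g Phi, ann f (ann g Phi) + ann g (ann f Phi) = 0 ;
  car_cre : forall f g Phi, cre f (cre g Phi) + cre g (cre f Phi) = 0 ;
  car_mixed : forall f g Phi,
    ann f (cre g Phi) + cre g (ann f Phi) = inner (J f) g *: Phi ;
  ann_adjoint : forall f, is_adjoint (ann f) (cre (J f)) ;
  vac_unit : `|vac| = 1 ;
  ann_vac : forall f, ann f vac = 0 ;
  vac_cyclic : dense (lspan (range (foldr cre vac))) }.

Variable W : fock_rep.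

Definition nparticle (n : nat) : set F :=
  closure (lspan (foldr (cre W) (vac W) @` [set s | size s = n])).

Definition finite_particle : set F := lspan (\bigcup_n nparticle n).

Definition Delta (e : nat -> L) (A : L -> L) (Phi : F) : F :=
  limn (series (fun j => ann W (A (e j)) (ann W (J (e j)) Phi))).

Definition number_op (e : nat -> L) (Phi : F) : F :=
  limn (series (fun j => cre W (e j) (ann W (J (e j)) Phi))).

(* The graph on F_0 of N^s: Phi is decomposed into eigenvectors of N for the
   eigenvalues n, and the n-th component is multiplied by n^s. N is n on the
   n-particle space, so its spectrum is the set of natural numbers. With powR,
   0 `^ s is 0 for s != 0 and 0 `^ 0 is 1, so N^0 is the identity. *)
Definition number_pow (e : nat -> L) (s : R) (Phi Psi : F) : Prop :=
  exists (m : nat) (x : nat -> F),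
    [/\ forall n, finite_particle (x n) /\
                  number_op e (x n) = n%:R *: x n,
        Phi = \sum_(n < m) x n &
        Psi = \sum_(n < m) (n%:R `^ s)%:C *: x n].

End Fock.

(* Main.v *)
Require Import Defs.
From HB Require Import structures.
From mathcomp Require Import all_boot all_order all_algebra complex.
From mathcomp Require Import all_classical all_reals all_analysis.
From mathcomp Require Import ring.
Import Order.TTheory GRing.Theory Num.Theory.
Import numFieldNormedType.Exports.
Local Open Scope classical_set_scope.
Local Open Scope ring_scope.
Local Open Scope complex_scope.

Set Implicit Arguments.
Unset Strict Implicit.
Unset Printing Implicit Defensive.

(* C := J A is antilinear with (f, C g) = - (g, C f) and C^2 = - A^* A, so an
   eigenspace of A^* A for l^2 > 0 splits into orthonormal pairs (f, g) with
   C f = l g and C g = - l f. Given 2 m pairs with l >= lam, let X be the sum,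
   over the sets S of m pairs, of the vectors prod_{p in S} a^+(f_p) a^+(g_p) Omega.
   Then N X = 2 m X, and Delta(A) X has a component along the analogous sum X' over
   the sets of m - 1 pairs which yields |Delta(A) X|^2 >= 4 lam^2 m^2 |X|^2. The
   hypothesis gives 4 lam^2 m^2 <= gamma (2 m)^s + delta, that is
   m = O(lam^(- r)): the number of singular values of A above lam is
   O(lam^(- r)), and the power sums of exponent r + eps converge. *)

(** * The inner product *)

Section InnerProduct.
Variables (R : realType) (L : hilbertType R).
Implicit Types (u v w : L) (a : R[i]).

Lemma innerDr u v w : inner u (v + w) = inner u v + inner u w.
Proof. exact: linearDl. Qed.

Lemma innerDl u v w : inner (u + v) w = inner u w + inner v w.
Proof. exact: linearDr. Qed.

Lemma innerZr a u v : inner u (a *: v) = a * inner u v.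
Proof. exact: linearZl_LR. Qed.

Lemma innerZl a u v : inner (a *: u) v = a^* * inner u v.
Proof. exact: linearZr_LR. Qed.

Lemma inner0r u : inner u 0 = 0.
Proof. exact: linear0l. Qed.

Lemma inner0l u : inner 0 u = 0.
Proof. exact: linear0r. Qed.

Lemma innerNr u v : inner u (- v) = - inner u v.
Proof. exact: linearNl. Qed.

Lemma innerNl u v : inner (- u) v = - inner u v.
Proof. exact: linearNr. Qed.

Lemma innerBr u v w : inner u (v - w) = inner u v - inner u w.
Proof. by rewrite innerDr innerNr. Qed.

Lemma innerBl u v w : inner (u - v) w = inner u w - inner v w.
Proof. by rewrite innerDl innerNl. Qed.

Lemma inner_sumr (I : Type) (s : seq I) (P : pred I) (E : I -> L) u :
  inner u (\sum_(i <- s | P i) E i) = \sum_(i <- s | P i) inner u (E i).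
Proof. exact: linear_sumlz. Qed.

Lemma innerC u v : inner u v = (inner v u)^*%R.
Proof. by rewrite /inner hermC expr0 mul1r. Qed.

Lemma inner_norm u : inner u u = `|u| ^+ 2.
Proof. exact: hdot_norm. Qed.

Lemma inner_ge0 u : 0 <= inner u u.
Proof. by rewrite inner_norm exprn_ge0. Qed.

Lemma inner_eq0 u : (inner u u == 0) = (u == 0).
Proof. by rewrite inner_norm expf_eq0 normr_eq0. Qed.

Lemma pythagoras u v : inner u v = 0 ->
  `|u + v| ^+ 2 = `|u| ^+ 2 + `|v| ^+ 2.
Proof.
move=> uv; rewrite -!inner_norm !innerDl !innerDr uv (innerC v) uv conjC0.
by rewrite addr0 add0r.
Qed.

(** Pythagoras for the projection [c *: u] of [v] on [u] and the orthogonal remainder [v - c *: u],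
    whose contribution is dropped. *)
Lemma cauchy_schwarz u v : `|inner u v| ^+ 2 <= `|u| ^+ 2 * `|v| ^+ 2.
Proof.
have [->|u0] := eqVneq u 0.
  by rewrite inner0l normr0 expr0n /= mulr_ge0 ?exprn_ge0.
pose c := inner u v / inner u u.
have uu0 : inner u u != 0 by rewrite inner_eq0.
have ort : inner (v - c *: u) (c *: u) = 0.
  by rewrite innerC innerZl innerBr innerZr /c divfK // subrr mulr0 conjC0.
have := pythagoras ort; rewrite subrK => ->.
rewrite mulrDr ler_wpDl ?mulr_ge0 ?exprn_ge0 //.
suff -> : `|u| ^+ 2 * `|c *: u| ^+ 2 = `|inner u v| ^+ 2 by [].
rewrite normrZ -exprMn; congr (_ ^+ 2).
have -> : `|u| * (`|c| * `|u|) = `|c| * `|u| ^+ 2 by ring.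
rewrite -inner_norm.
have -> : inner u u = `|inner u u| by rewrite ger0_norm ?inner_ge0.
by rewrite -normrM divfK.
Qed.

Lemma norm_le_of_sqr u v : `|u| ^+ 2 <= `|v| ^+ 2 -> `|u| <= `|v|.
Proof. by rewrite ler_sqr ?nnegrE. Qed.

End InnerProduct.

(** * Fourier expansions and conjugations *)

(** The limits on Fock space are deduced from Fourier expansions through Lipschitz bounds of this
    kind. *)
Lemma cvg_norm_le (K : numFieldType) (U V : normedModType K) (f : nat -> U)
    (g : nat -> V) (a : U) (b : V) (c : K) :
  0 <= c -> f @ \oo --> a -> (forall n, `|b - g n| <= c * `|a - f n|) ->
  g @ \oo --> b.
Proof.
move=> c0 /cvgrPdist_le fa fg; apply/cvgrPdist_le => eps eps0.
(* The divisor is [c + 1] because [c] may be 0. *)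
have c1 : 0 < c + 1 by rewrite ltr_wpDl.
have := fa (eps / (c + 1)) (divr_gt0 eps0 c1).
apply: filterS => n /= fan; apply: (le_trans (fg n)).
apply: (@le_trans _ _ ((c + 1) * (eps / (c + 1)))); last first.
  by rewrite mulrC divfK ?gt_eqF.
apply: ler_pM => //; rewrite ler_wpDr //.
Qed.

Section Fourier.
Variables (R : realType) (L : hilbertType R) (e : nat -> L).
Hypothesis e_cons : complete_orthonormal e.

Let e_on i j : inner (e i) (e j) = (i == j)%:R := e_cons.1 i j.

Definition fourier n (f : L) : L :=
  \sum_(0 <= j < n) inner (e j) f *: e j.

Lemma fourierD n f g : fourier n (f + g) = fourier n f + fourier n g.
Proof.
rewrite /fourier -big_split /=; apply: eq_bigr => j _.
by rewrite innerDr scalerDl.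
Qed.

Lemma fourierZ n (c : R[i]) f : fourier n (c *: f) = c *: fourier n f.
Proof.
rewrite /fourier scaler_sumr; apply: eq_bigr => j _.
by rewrite innerZr scalerA.
Qed.

Lemma inner_fourier n f k : (k < n)%N -> inner (e k) (fourier n f) = inner (e k) f.
Proof.
move=> kn; rewrite /fourier inner_sumr big_mkord (bigD1 (Ordinal kn)) //=.
rewrite innerZr e_on eqxx mulr1 big1 ?addr0 // => j jk.
rewrite innerZr e_on; case: eqP => [kj|_]; last by rewrite mulr0.
by move: jk; rewrite -val_eqE /= kj eqxx.
Qed.

(** The partial sum is the orthogonal projection on the first [n] vectors, so the remainder is
    orthogonal to it. *)
Lemma fourier_le n f : `|f - fourier n f| <= `|f|.
Proof.
apply: norm_le_of_sqr.
suff ort : inner (f - fourier n f) (fourier n f) = 0.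
  by have := pythagoras ort; rewrite subrK => ->; rewrite ler_wpDr ?exprn_ge0.
rewrite {2}/fourier inner_sumr big_nat big1 // => k /andP[_ kn].
rewrite innerZr [inner (_ - _) _]innerC innerBr inner_fourier // subrr.
by rewrite conjC0 mulr0.
Qed.

Lemma fourier_lspan v : lspan (range e) v ->
  exists N, forall n, (N <= n)%N -> fourier n v = v.
Proof.
move=> [m [c [x [xe ->]]]].
elim/big_ind: _ => [|u w [N1 h1] [N2 h2]|i _].
- exists 0%N => n _; rewrite /fourier big1 // => j _.
  by rewrite inner0r scale0r.
- exists (maxn N1 N2) => n; rewrite geq_max => /andP[n1 n2].
  by rewrite fourierD h1 ?h2.
- have [k _ <-] := xe i; exists k.+1 => n kn.
  rewrite fourierZ /fourier big_mkord (bigD1 (Ordinal kn)) //=.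
  rewrite e_on eqxx scale1r big1 ?addr0 // => j jk.
  rewrite e_on; case: eqP => [kj|_]; last by rewrite scale0r.
  by move: jk; rewrite -val_eqE /= kj eqxx.
Qed.

(** By density some [v] in the span of the [e j] is close to [f]. For large [n] the expansion
    reproduces [v], so the remainder of [f] is that of [f - v], whose norm is at most that of
    [f - v]. *)
Lemma fourier_cvg f : (fun n => fourier n f) @ \oo --> f.
Proof.
apply/cvgrPdist_le => eps eps0.
have [v [vf /fourier_lspan[N vN]]] : ball f eps `&` lspan (range e) !=set0.
  by apply: e_cons.2; [exists f; exact: ballxx|exact: ball_open].
exists N => // n /= Nn.
have -> : f - fourier n f = f - v - fourier n (f - v).
  by rewrite -[- v]scaleN1r fourierD fourierZ vN // scaleN1r; rewrite opprB addrA subrK.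
apply: (le_trans (fourier_le _ _)).
by move: vf; rewrite -ball_normE /= => /ltW.
Qed.

End Fourier.

Section Conjugation.
Variables (R : realType) (L : hilbertType R) (J : L -> L).
Hypothesis J_conj : conjugation J.

Let J_lin (c : R[i]) f g : J (c *: f + g) = c^* *: J f + J g.
Proof. by case: J_conj. Qed.

Lemma conjugationK : involutive J. Proof. by case: J_conj. Qed.

Lemma conjugation_norm f : `|J f| = `|f|. Proof. by case: J_conj. Qed.

Lemma conjugationD f g : J (f + g) = J f + J g.
Proof. by have := J_lin 1 f g; rewrite scale1r rmorph1 scale1r. Qed.

Lemma conjugation0 : J 0 = 0.
Proof. by apply: (addrI (J 0)); rewrite -conjugationD !addr0. Qed.

Lemma conjugationZ (c : R[i]) f : J (c *: f) = c^* *: J f.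
Proof. by have := J_lin c f 0; rewrite conjugation0 !addr0. Qed.

Lemma conjugationN f : J (- f) = - J f.
Proof. by rewrite -scaleN1r conjugationZ rmorphN rmorph1 scaleN1r. Qed.

Lemma conjugation_sum (I : Type) (s : seq I) (P : pred I) (E : I -> L) :
  J (\sum_(i <- s | P i) E i) = \sum_(i <- s | P i) J (E i).
Proof. exact: (big_morph J conjugationD conjugation0). Qed.

(* Polarization, applied to (f, g) and to (f, 'i g). *)
Lemma inner_conjugation f g : inner (J f) (J g) = inner g f.
Proof.
have pol u v : inner (J u) (J v) + inner (J v) (J u) = inner u v + inner v u.
  have /eqP := congr1 (fun x => x ^+ 2) (conjugation_norm (u + v)).
  rewrite -!inner_norm conjugationD !innerDl !innerDr !inner_norm.
  rewrite !conjugation_norm => /eqP h.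
  apply: (addrI (`|u| ^+ 2)); apply: (addIr (`|v| ^+ 2)).
  by rewrite -!addrA in h *; rewrite !addrA in h *; exact: h.
have ii : ('i%C : R[i])^*%R = - 'i%C by apply/eqP; rewrite eq_complex /= oppr0 !eqxx.
have i0 : ('i%C : R[i]) != 0 by rewrite eq_complex /= oner_eq0 andbF.
have h1 := pol f g; have := pol f ('i%C *: g).
rewrite conjugationZ ii !innerZr !innerZl rmorphN /= ii opprK => h2.
have h3 : inner (J g) (J f) - inner (J f) (J g) = inner f g - inner g f.
  apply: (mulfI i0); rewrite !mulrBr [LHS]addrC -mulNr h2.
  by rewrite mulNr.
apply: (@mulfI _ 2%:R); rewrite ?pnatr_eq0 //.
have := congr2 (fun x y => x - y) h1 h3 => /= h4.
by transitivity (inner (J f) (J g) + inner (J g) (J f) -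
  (inner (J g) (J f) - inner (J f) (J g))); [ring|rewrite h4; ring].
Qed.

End Conjugation.

Lemma cvgD_seq (K : numFieldType) (V : normedModType K) (f g : nat -> V) a b :
  f @ \oo --> a -> g @ \oo --> b -> (fun n => f n + g n) @ \oo --> a + b.
Proof. by move=> fa gb; exact: (cvgD fa gb). Qed.

(** The open balls of radius [n] cover the compact closure of the image of the unit ball; a finite
    subcover bounds this image, and scaling gives the bound on all of [L]. *)
Lemma compact_operator_bounded (R : realType) (L : hilbertType R)
    (A : {linear L -> L}) : compact_operator A ->
  exists2 k : R[i], 0 <= k & forall f, `|A f| <= k * `|f|.
Proof.
rewrite /compact_operator precompactE compact_cover => cA.
have [|x _|D _ AD] := cA nat setT (fun n => [set x : L | `|x| < n%:R]).
- move=> n _; have -> : [set x : L | `|x| < n%:R] = [set x | `|0 - x| < n%:R].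
    by apply/seteqP; split => x /=; rewrite sub0r normrN.
  case: n => [|n].
    suff -> : [set x : L | `|0 - x| < 0%:R] = set0 by exact: open0.
    by apply/seteqP; split => x //=; rewrite normr_lt0.
  have := @ball_open _ L 0 n.+1%:R; rewrite -ball_normE; apply.
- have [y [xy /complex_realP[k yk]]] : exists y : R[i], `|x| <= y /\ y \is Num.real.
    by exists `|x|; rewrite normr_real.
  have /andP[_ h] := Num.Theory.truncn_itv (normr_ge0 k).
  exists (Num.truncn `|k|).+1 => //=.
  apply: (le_lt_trans xy); rewrite yk -(rmorph_nat (real_complex R)) ltcR.
  by apply: le_lt_trans h; rewrite ler_norm.
pose N := (\max_(i <- finmap.enum_fset D) i)%N.
have AN f : `|f| <= 1 -> `|A f| <= N%:R.
  move=> f1.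
  have [|i /= iD fi] := AD (A f).
    by apply: subset_closure; exists f.
  apply: (le_trans (ltW fi)); rewrite ler_nat.
  exact: (@leq_bigmax_seq _ _ _ id).
exists N%:R => // f; have [->|f0] := eqVneq f 0.
  by rewrite linear0 !normr0 mulr0.
have nf : 0 < `|f| by rewrite normr_gt0.
have := AN (`|f|^-1 *: f); rewrite linearZ !normrZ normfV normr_id.
rewrite mulVf ?gt_eqF // => /(_ (lexx _)).
by rewrite mulrC ler_pdivrMr.
Qed.

(** * The Fock representation *)

Section LinearSpanTheory.
Variables (K : fieldType) (V : lmodType K) (S : set V).

Lemma lspan0 : lspan S 0.
Proof.
exists 0%N, (fun=> 0), (fun=> 0); split; first by case.
by rewrite big_ord0.
Qed.

Lemma sub_lspan v : S v -> lspan S v.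
Proof.
by move=> Sv; exists 1%N, (fun=> 1), (fun=> v); rewrite big_ord1 scale1r.
Qed.

Lemma lspanD u v : lspan S u -> lspan S v -> lspan S (u + v).
Proof.
move=> [m [c [x [xS ->]]]] [n [d [y [yS ->]]]].
exists (m + n)%N, (fun i => match fintype.split i with inl j => c j | inr j => d j end),
  (fun i => match fintype.split i with inl j => x j | inr j => y j end); split.
  by move=> i; case: fintype.splitP.
rewrite big_split_ord /=; congr (_ + _); apply: eq_bigr => i _.
  by have := unsplitK (inl i : 'I_m + 'I_n) => /= ->.
by have := unsplitK (inr i : 'I_m + 'I_n) => /= ->.
Qed.

End LinearSpanTheory.

Section FockAlgebra.
Variables (R : realType) (L : hilbertType R) (J : L -> L) (F : hilbertType R).
Variable W : fock_rep J F.
Hypothesis J_conj : conjugation J.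
Implicit Types (f g u : L) (Phi Psi X Y : F) (z : R[i]).

Let JK : involutive J := conjugationK J_conj.

Lemma ann0 Phi : ann W 0 Phi = 0.
Proof.
by have := ann_linear W (-1) 0 0 Phi; rewrite scaler0 addr0 scaleN1r addNr.
Qed.

Lemma cre0 Phi : cre W 0 Phi = 0.
Proof.
by have := cre_linear W (-1) 0 0 Phi; rewrite scaler0 addr0 scaleN1r addNr.
Qed.

Lemma annD f g Phi : ann W (f + g) Phi = ann W f Phi + ann W g Phi.
Proof. by have := ann_linear W 1 f g Phi; rewrite !scale1r. Qed.

Lemma creD f g Phi : cre W (f + g) Phi = cre W f Phi + cre W g Phi.
Proof. by have := cre_linear W 1 f g Phi; rewrite !scale1r. Qed.

Lemma annZ z f Phi : ann W (z *: f) Phi = z *: ann W f Phi.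
Proof. by have := ann_linear W z f 0 Phi; rewrite !addr0 ann0 addr0. Qed.

Lemma creZ z f Phi : cre W (z *: f) Phi = z *: cre W f Phi.
Proof. by have := cre_linear W z f 0 Phi; rewrite !addr0 cre0 addr0. Qed.

Lemma annB f g Phi : ann W (f - g) Phi = ann W f Phi - ann W g Phi.
Proof. by rewrite annD -[- g]scaleN1r annZ scaleN1r. Qed.

Lemma creB f g Phi : cre W (f - g) Phi = cre W f Phi - cre W g Phi.
Proof. by rewrite creD -[- g]scaleN1r creZ scaleN1r. Qed.

Lemma ann_sum (I : Type) (s : seq I) (P : pred I) (E : I -> L) Phi :
  ann W (\sum_(i <- s | P i) E i) Phi = \sum_(i <- s | P i) ann W (E i) Phi.
Proof.
by apply: (big_morph (fun f => ann W f Phi)) => [f g|]; [exact: annD|exact: ann0].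
Qed.

Lemma cre_sum (I : Type) (s : seq I) (P : pred I) (E : I -> L) Phi :
  cre W (\sum_(i <- s | P i) E i) Phi = \sum_(i <- s | P i) cre W (E i) Phi.
Proof.
by apply: (big_morph (fun f => cre W f Phi)) => [f g|]; [exact: creD|exact: cre0].
Qed.

Lemma inner_cre f Phi Psi : inner (cre W f Phi) Psi = inner Phi (ann W (J f) Psi).
Proof. by rewrite -(ann_adjoint W (J f)) JK. Qed.

Lemma ann_creE f g Phi :
  ann W (J f) (cre W g Phi) = inner f g *: Phi - cre W g (ann W (J f) Phi).
Proof. by rewrite -[in inner f g](JK f) -(car_mixed W) addrK. Qed.

Lemma cre_anticomm f g Phi : cre W f (cre W g Phi) = - cre W g (cre W f Phi).
Proof. by apply/eqP; rewrite -addr_eq0 (car_cre W). Qed.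

(** The anticommutator of a(J f) and a^+(f) is |f|^2; its expectation in [Phi] bounds both operators
    at once. *)
Lemma norm_ann_cre f Phi :
  `|ann W (J f) Phi| ^+ 2 + `|cre W f Phi| ^+ 2 = `|f| ^+ 2 * `|Phi| ^+ 2.
Proof.
rewrite -!inner_norm [inner (cre _ _ _) _]inner_cre ann_creE innerBr innerZr.
rewrite [inner Phi (cre _ _ _)]innerC inner_cre -[(inner _ _)^*%R]innerC.
by rewrite addrC subrK !inner_norm.
Qed.

Lemma norm_ann_le f Phi : `|ann W f Phi| <= `|f| * `|Phi|.
Proof.
rewrite -ler_sqr ?nnegrE ?mulr_ge0 // exprMn -[f]JK (conjugation_norm J_conj).
by rewrite -norm_ann_cre ler_wpDr ?exprn_ge0 ?lexx.
Qed.

Lemma norm_cre_le f Phi : `|cre W f Phi| <= `|f| * `|Phi|.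
Proof.
rewrite -ler_sqr ?nnegrE ?mulr_ge0 // exprMn.
by rewrite -norm_ann_cre ler_wpDl ?exprn_ge0 ?lexx.
Qed.

Lemma cvg_ann (u : nat -> L) f Phi : u @ \oo --> f ->
  (fun n => ann W (u n) Phi) @ \oo --> ann W f Phi.
Proof.
move=> uf; apply: (cvg_norm_le (normr_ge0 Phi) uf) => n.
by rewrite -annB mulrC norm_ann_le.
Qed.

Lemma cvg_cre (u : nat -> L) f Phi : u @ \oo --> f ->
  (fun n => cre W (u n) Phi) @ \oo --> cre W f Phi.
Proof.
move=> uf; apply: (cvg_norm_le (normr_ge0 Phi) uf) => n.
by rewrite -creB mulrC norm_cre_le.
Qed.

Lemma cvg_cre_r f (u : nat -> F) Phi : u @ \oo --> Phi ->
  (fun n => cre W f (u n)) @ \oo --> cre W f Phi.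
Proof.
move=> uf; apply: (cvg_norm_le (normr_ge0 f) uf) => n.
by rewrite -linearB norm_cre_le.
Qed.

Definition pair_cre f g Phi : F := cre W f (cre W g Phi).

Lemma ann_pair_cre u f g Phi : inner u f = 0 -> inner u g = 0 ->
  ann W (J u) Phi = 0 -> ann W (J u) (pair_cre f g Phi) = 0.
Proof.
move=> uf ug uPhi.
by rewrite /pair_cre !ann_creE uf ug uPhi linear0 !scale0r subrr linear0 subrr.
Qed.

(** Moving a^+(f) across the inner product kills the cross terms, since a(J f) annihilates [X] and
    [X']; on vectors free of both modes, creating the pair preserves inner products. This is the
    induction step for norms and pairings of the vectors [dicke]. *)
Lemma inner_add_pair_cre f g X X' Y Y' :
  inner f f = 1 -> inner g g = 1 -> inner f g = 0 ->
  ann W (J f) X = 0 -> ann W (J f) X' = 0 ->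
  ann W (J f) Y' = 0 -> ann W (J f) Y = 0 -> ann W (J g) Y' = 0 ->
  inner (X + pair_cre f g Y) (X' + pair_cre f g Y') = inner X X' + inner Y Y'.
Proof.
move=> ff gg fg fX fX' fY' fY gY'.
have cross Z Z' : ann W (J f) Z' = 0 -> inner (pair_cre f g Z) Z' = 0.
  by move=> fZ'; rewrite inner_cre fZ' inner0r.
rewrite innerDl !innerDr cross // [inner X (pair_cre _ _ _)]innerC cross // conjC0.
rewrite addr0 add0r inner_cre /pair_cre !ann_creE ff fg fY' linear0 subr0 scale0r.
by rewrite linear0 subr0 scale1r inner_cre ann_creE gg gY' linear0 subr0 scale1r.
Qed.

(* A triple (f, g, l) stands for the pair of modes f, g with singular value l;
   dicke ps m is the sum over the sets S of m pairs of ps of the products of the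
   pair_cre f g, (f, g, l) in S, applied to the vacuum. *)
Fixpoint dicke (ps : seq (L * L * R)) m : F :=
  match ps, m with
  | [::], 0 => vac W
  | [::], _.+1 => 0
  | p :: ps', 0 => dicke ps' 0
  | p :: ps', m'.+1 => dicke ps' m'.+1 + pair_cre p.1.1 p.1.2 (dicke ps' m')
  end.

(* The value of Delta(A) on dicke ps m when A f = l J g and A g = - l J f for all
   (f, g, l) in ps. *)
Fixpoint dicke_delta (ps : seq (L * L * R)) m : F :=
  match ps, m with
  | [::], _ => 0
  | p :: ps', 0 => dicke_delta ps' 0
  | p :: ps', m'.+1 => (dicke_delta ps' m'.+1 + (2 * p.2)%:C *: dicke ps' m') +
      pair_cre p.1.1 p.1.2 (dicke_delta ps' m')
  end.

Definition orth_pair u (p : L * L * R) : Prop :=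
  inner u p.1.1 = 0 /\ inner u p.1.2 = 0.

Lemma ann_dicke u ps m : (forall p, p \in ps -> orth_pair u p) ->
  ann W (J u) (dicke ps m) = 0.
Proof.
elim: ps m => [|p ps IH] [|m] ups /=; rewrite ?ann_vac ?linear0 //.
  by apply: IH => q qps; apply: ups; rewrite inE qps orbT.
have [up1 up2] := ups p (mem_head _ _).
have {}IH k : ann W (J u) (dicke ps k) = 0.
  by apply: IH => q qps; apply: ups; rewrite inE qps orbT.
by rewrite linearD IH ann_pair_cre ?addr0.
Qed.

Lemma ann_dicke_delta u ps m : (forall p, p \in ps -> orth_pair u p) ->
  ann W (J u) (dicke_delta ps m) = 0.
Proof.
elim: ps m => [|p ps IH] [|m] ups /=; rewrite ?linear0 //.
  by apply: IH => q qps; apply: ups; rewrite inE qps orbT.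
have [up1 up2] := ups p (mem_head _ _).
have ups' q : q \in ps -> orth_pair u q.
  by move=> qps; apply: ups; rewrite inE qps orbT.
by rewrite !linearD linearZ /= IH // ann_dicke // ann_pair_cre ?IH // scaler0 !addr0.
Qed.

(** All the modes f, g of the list are orthonormal. The recursive form splits off the head in step
    with the recursion of [dicke]. *)
Fixpoint pair_system (ps : seq (L * L * R)) : Prop :=
  if ps is p :: ps' then
    [/\ inner p.1.1 p.1.1 = 1, inner p.1.2 p.1.2 = 1, inner p.1.1 p.1.2 = 0,
        forall q, q \in ps' -> orth_pair p.1.1 q /\ orth_pair p.1.2 q &
        pair_system ps']
  else True.

(** The products over different sets of [m] pairs are orthonormal, so the squared norm counts these
    sets; the induction is Pascal's rule. *)
Lemma dicke_norm ps m : pair_system ps ->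
  inner (dicke ps m) (dicke ps m) = 'C(size ps, m)%:R.
Proof.
elim: ps m => [|p ps IH] [|m] /=.
- by move=> _; rewrite inner_norm vac_unit expr1n.
- by rewrite inner0l.
- by case=> _ _ _ _ /(IH 0%N); rewrite !bin0.
move=> [ff gg fg orth ps_sys].
rewrite inner_add_pair_cre ?ann_dicke // ?IH //; try by move=> q /orth[].
by rewrite binS natrD.
Qed.

(** Delta(A) removes one pair (f, g, l) from a set of m + 1 pairs, with factor 2 l. Each set of m +
    1 pairs contains m + 1 sets of m pairs, and each such inclusion contributes 2 l >= 2 lam. *)
Lemma dicke_pairing (lam : R) ps m : pair_system ps ->
  (forall p, p \in ps -> lam <= p.2) ->
  (2 * lam)%:C * (m.+1 * 'C(size ps, m.+1))%:R <=
    inner (dicke ps m) (dicke_delta ps m.+1).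
Proof.
elim: ps m => [|p ps IH] m /=.
  by move=> _ _; rewrite bin0n muln0 mulr0 inner0r.
move=> [ff gg fg orth ps_sys] lamps.
have lamp : (2 * lam)%:C <= (2 * p.2)%:C :> R[i].
  by rewrite lecR ler_pM2l // lamps ?mem_head.
have {}lamps q : q \in ps -> lam <= q.2.
  by move=> qps; apply: lamps; rewrite inE qps orbT.
(* Contribution of the sets of [k] pairs without the head [p]: they come from larger sets without
   [p], or from themselves enlarged by [p], which is then removed. *)
have key k : (2 * lam)%:C * (k.+1 * 'C(size ps, k.+1) + 'C(size ps, k))%:R <=
  inner (dicke ps k) (dicke_delta ps k.+1 + (2 * p.2)%:C *: dicke ps k).
  rewrite natrD mulrDr innerDr innerZr dicke_norm // lerD ?IH //.
  by rewrite ler_wpM2r.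
have annX u k : u = p.1.1 \/ u = p.1.2 -> ann W (J u) (dicke ps k) = 0.
  by case=> ->; apply: ann_dicke => q /orth[].
have annD u k : u = p.1.1 \/ u = p.1.2 -> ann W (J u) (dicke_delta ps k) = 0.
  by case=> ->; apply: ann_dicke_delta => q /orth[].
have annXD u k : u = p.1.1 \/ u = p.1.2 ->
    ann W (J u) (dicke_delta ps k.+1 + (2 * p.2)%:C *: dicke ps k) = 0.
  by move=> up; rewrite linearD linearZ /= annX // annD // scaler0 addr0.
(* [dicke (p :: ps) 0] has no [pair_cre] summand, so this case is treated apart. *)
case: m => [|m].
  rewrite innerDr [inner _ (pair_cre _ _ _)]innerC inner_cre annX; last by left.
  rewrite inner0r conjC0 addr0; apply: le_trans (key 0%N).
  by rewrite !mul1n !bin0 !bin1 addn1.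
rewrite inner_add_pair_cre ?annX ?annXD ?annD //; try by [left|right].
apply: le_trans (lerD (key m.+1) (IH m ps_sys lamps)).
rewrite -mulrDr -natrD le_eqVlt binS; apply/orP; left; apply/eqP.
by congr (_ * _%:R); ring.
Qed.

Definition monomials n : set F := foldr (cre W) (vac W) @` [set s | size s = n].

Lemma lspan_monomials_cre n f v :
  lspan (monomials n) v -> lspan (monomials n.+1) (cre W f v).
Proof.
move=> [k [c [x [xn ->]]]]; exists k, c, (fun i => cre W f (x i)); split.
  by move=> i; have [s /= <- <-] := xn i; exists (f :: s).
by rewrite linear_sum; apply: eq_bigr => i _; rewrite linearZ.
Qed.

Lemma dicke_lspan ps m : lspan (monomials m.*2) (dicke ps m).
Proof.
elim: ps m => [|p ps IH] [|m] //=.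
- by apply: sub_lspan; exists [::].
- exact: lspan0.
apply: lspanD; first exact: IH.
by rewrite doubleS; do 2 apply: lspan_monomials_cre; exact: IH.
Qed.

End FockAlgebra.

(** * The number operator and Delta(A) on the vectors [dicke] *)

Section FockLimits.
Variables (R : realType) (L : hilbertType R) (J : L -> L) (F : hilbertType R).
Variable W : fock_rep J F.
Hypothesis J_conj : conjugation J.
Variable e : nat -> L.
Hypothesis e_cons : complete_orthonormal e.
Implicit Types (f g u : L) (Phi Psi X Y : F).

Let JK : involutive J := conjugationK J_conj.

Definition number_sum n Phi : F :=
  \sum_(0 <= j < n) cre W (e j) (ann W (J (e j)) Phi).

Lemma number_sumD n Phi Psi :
  number_sum n (Phi + Psi) = number_sum n Phi + number_sum n Psi.
Proof. by rewrite -big_split /=; apply: eq_bigr => j _; rewrite !linearD. Qed.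

(** The commutator of the truncated number operator with a^+(f) is a^+ of the truncated f; in the
    limit each creation operator raises the eigenvalue by 1. *)
Lemma number_sum_cre n f Phi :
  number_sum n (cre W f Phi) = cre W f (number_sum n Phi) + cre W (fourier e n f) Phi.
Proof.
rewrite linear_sum cre_sum // -big_split /=; apply: eq_bigr => j _.
rewrite ann_creE // linearB linearZ /= cre_anticomm creZ.
by rewrite addrC.
Qed.

Lemma number_cvg_cre f Phi Psi : (number_sum ^~ Phi) @ \oo --> Psi ->
  (number_sum ^~ (cre W f Phi)) @ \oo --> cre W f Psi + cre W f Phi.
Proof.
move=> h; under eq_fun do rewrite number_sum_cre.
apply: cvgD_seq; first exact: cvg_cre_r.
by apply: cvg_cre => //; exact: fourier_cvg.
Qed.

Lemma number_cvg_dicke ps m :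
  (number_sum ^~ (dicke W ps m)) @ \oo --> (m.*2)%:R *: dicke W ps m.
Proof.
have nvac : (number_sum ^~ (vac W)) @ \oo --> (0 : F).
  rewrite (_ : (fun n => _) = fun=> 0); first exact: cvg_cst.
  apply/funext => n; rewrite /number_sum big1 // => j _.
  by rewrite ann_vac linear0.
have n0 : (number_sum ^~ (0 : F)) @ \oo --> (0 : F).
  rewrite (_ : (fun n => _) = fun=> 0); first exact: cvg_cst.
  by apply/funext => n; rewrite /number_sum big1 // => j _; rewrite !linear0.
elim: ps m => [|p ps IH] [|m] /=; rewrite ?scale0r ?scaler0 //.
  by have := IH 0%N; rewrite scale0r.
under eq_fun do rewrite number_sumD.
rewrite scalerDr; apply: cvgD_seq; first exact: IH.
have := number_cvg_cre (f := p.1.1) (number_cvg_cre (f := p.1.2) (IH m)).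
rewrite -/(pair_cre _ _ _ _) !linearD !linearZ /= -/(pair_cre _ _ _ _).
by rewrite doubleS -[m.*2.+2]addn2 natrD scalerDl [2 *: _]scaler_nat mulr2n addrA.
Qed.

Variable A : {linear L -> L}.
Variable k : R[i].
Hypothesis k_ge0 : 0 <= k.
Hypothesis A_bounded : forall f, `|A f| <= k * `|f|.
Hypothesis A_skew : is_transpose J A (fun f => - A f).

(** Written for J A, skewness is the antisymmetry of (f, J A g), without any adjoint. *)
Lemma inner_skew f g : inner f (J (A g)) = - inner g (J (A f)).
Proof.
have := A_skew f (J g); rewrite JK => <-.
by rewrite innerNl -[A f]JK inner_conjugation // JK.
Qed.

Definition delta_sum n Phi : F :=
  \sum_(0 <= j < n) ann W (A (e j)) (ann W (J (e j)) Phi).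

Lemma delta_sumD n Phi Psi :
  delta_sum n (Phi + Psi) = delta_sum n Phi + delta_sum n Psi.
Proof. by rewrite -big_split /=; apply: eq_bigr => j _; rewrite !linearD. Qed.

(** Either annihilation operator can be contracted with a^+(f). Skewness turns the contraction with
    a(A e_j) into an expansion of J A f. Both terms tend to a(A f), whence the factor 2 in
    [delta_cvg_cre]. *)
Lemma delta_sum_cre n f Phi :
  delta_sum n (cre W f Phi) = cre W f (delta_sum n Phi) +
    (ann W (A (fourier e n f)) Phi + ann W (J (fourier e n (J (A f)))) Phi).
Proof.
rewrite linear_sum [A _]linear_sum conjugation_sum // !ann_sum -!big_split /=.
apply: eq_bigr => j _.
rewrite ann_creE // linearB linearZ /= -[X in ann W X (cre W f _)]JK ann_creE //.
rewrite JK opprB addrCA [A (_ *: _)]linearZ annZ; congr (_ + (_ + _)).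
rewrite (conjugationZ J_conj) annZ -[(inner _ _)^*%R]innerC -scaleNr; congr (_ *: _).
by rewrite [inner (J (A f)) _]innerC inner_skew rmorphN /= -[(inner _ _)^*%R]innerC.
Qed.

Lemma delta_cvg_cre f Phi Psi : (delta_sum ^~ Phi) @ \oo --> Psi ->
  (delta_sum ^~ (cre W f Phi)) @ \oo --> cre W f Psi + 2 *: ann W (A f) Phi.
Proof.
move=> h; under eq_fun do rewrite delta_sum_cre.
apply: cvgD_seq; first exact: cvg_cre_r.
rewrite scaler_nat mulr2n; apply: cvgD_seq; apply: cvg_ann => //.
  apply: (cvg_norm_le k_ge0 (fourier_cvg e_cons (f := f))) => n.
  by rewrite -linearB A_bounded.
suff : (fun n => J (fourier e n (J (A f)))) @ \oo --> J (J (A f)) by rewrite JK.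
apply: (cvg_norm_le ler01 (fourier_cvg e_cons (f := J (A f)))) => n.
by rewrite -(conjugationN J_conj) -(conjugationD J_conj) (conjugation_norm J_conj) mul1r.
Qed.

Definition skew_pair (p : L * L * R) : Prop :=
  J (A p.1.1) = p.2%:C *: p.1.2 /\ J (A p.1.2) = - p.2%:C *: p.1.1.

Lemma delta_cvg_dicke ps m : pair_system ps ->
  (forall p, p \in ps -> skew_pair p) ->
  (delta_sum ^~ (dicke W ps m)) @ \oo --> dicke_delta W ps m.
Proof.
have nvac : (delta_sum ^~ (vac W)) @ \oo --> (0 : F).
  rewrite (_ : (fun n => _) = fun=> 0); first exact: cvg_cst.
  apply/funext => n; rewrite /delta_sum big1 // => j _.
  by rewrite ann_vac linear0.
have n0 : (delta_sum ^~ (0 : F)) @ \oo --> (0 : F).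
  rewrite (_ : (fun n => _) = fun=> 0); first exact: cvg_cst.
  by apply/funext => n; rewrite /delta_sum big1 // => j _; rewrite !linear0.
elim: ps m => [|p ps IH] [|m] //= [ff gg fg orth ps_sys] skew.
  by apply: IH => // q qps; apply: skew; rewrite inE qps orbT.
have [Jf Jg] := skew p (mem_head _ _).
have {}IH j : (delta_sum ^~ (dicke W ps j)) @ \oo --> dicke_delta W ps j.
  by apply: IH => // q qps; apply: skew; rewrite inE qps orbT.
under eq_fun do rewrite delta_sumD.
rewrite -addrA; apply: cvgD_seq; first exact: IH.
(* Passing a^+(g) and then a^+(f) leaves two new terms. As A g = - l J f, the term with a(A g)
   vanishes on the remaining pairs; as A f = l J g, a(A f) contracts with a^+(g) and yields the
   factor 2 l. *)
have := delta_cvg_cre (f := p.1.1) (delta_cvg_cre (f := p.1.2) (IH m)).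
rewrite -/(pair_cre _ _ _ _) linearD linearZ /= -/(pair_cre _ _ _ _).
rewrite -[A p.1.2]JK Jg (conjugationZ J_conj) annZ ann_dicke //; last by move=> q /orth[].
rewrite -[A p.1.1]JK Jf (conjugationZ J_conj) annZ ann_creE // gg ann_dicke //; last first.
  by move=> q /orth[].
rewrite scaler0 !(linear0 (cre W _)) subr0 scale1r scaler0 addr0 scalerA.
rewrite [X in _ + X](_ : _ = (2 * p.2)%:C *: dicke W ps m); first by rewrite addrC.
congr (_ *: _); rewrite rmorphM /= rmorph_nat; congr (_ * _).
exact: conjc_real.
Qed.

End FockLimits.

(** * The operator inequality bounds the number of pairs *)

Section PairCount.
Variables (R : realType) (L : hilbertType R) (J : L -> L) (F : hilbertType R).
Variable W : fock_rep J F.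
Hypothesis J_conj : conjugation J.
Variable e : nat -> L.
Hypothesis e_cons : complete_orthonormal e.
Variable A : {linear L -> L}.
Variable k : R[i].
Hypothesis k_ge0 : 0 <= k.
Hypothesis A_bounded : forall f, `|A f| <= k * `|f|.
Hypothesis A_skew : is_transpose J A (fun f => - A f).

Lemma Delta_dicke ps m : pair_system ps ->
  (forall p, p \in ps -> skew_pair J A p) ->
  Delta W e A (dicke W ps m) = dicke_delta W ps m.
Proof.
move=> ps_sys skew; apply: cvg_lim; first exact: norm_hausdorff.
exact: (delta_cvg_dicke J_conj e_cons k_ge0 A_bounded A_skew).
Qed.

Lemma number_op_dicke ps m :
  number_op W e (dicke W ps m) = (m.*2)%:R *: dicke W ps m.
Proof.
apply: cvg_lim; first exact: norm_hausdorff.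
exact: (number_cvg_dicke J_conj e_cons).
Qed.

Lemma number_op0 : number_op W e 0 = 0.
Proof. by have := number_op_dicke [::] 1; rewrite scaler0. Qed.

Lemma finite_particle_dicke ps m : finite_particle W (dicke W ps m).
Proof.
apply: sub_lspan; exists m.*2 => //.
exact/subset_closure/dicke_lspan.
Qed.

Lemma number_pow_dicke (s : R) ps m :
  number_pow W e s (dicke W ps m) (((m.*2)%:R `^ s)%:C *: dicke W ps m).
Proof.
(* Only the component of index 2 m is nonzero; the bound 2 m + 1 makes the sum reach it. *)
exists m.*2.+1, (fun n => if n == m.*2 then dicke W ps m else 0); split.
- move=> n; case: eqP => [->|_].
    by split; [exact: finite_particle_dicke|exact: number_op_dicke].
  by split; [exact: lspan0|rewrite number_op0 scaler0].
- rewrite big_ord_recr /= eqxx big1 ?add0r // => i _.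
  by rewrite ltn_eqF.
- rewrite big_ord_recr /= eqxx big1 ?add0r // => i _.
  by rewrite ltn_eqF // scaler0.
Qed.

Variables (s gamma delta : R).
Hypothesis Delta_bound : forall Phi Psi : F,
  finite_particle W Phi -> number_pow W e s Phi Psi ->
  `|Delta W e A Phi| ^+ 2 <=
    inner Phi (gamma%:C *: Psi + delta%:C *: Phi).

(** Cauchy-Schwarz for [dicke W ps m] and the image of [X] compares the lower bound on their pairing
    with the assumed upper bound on the image. Choosing half of an even number of pairs makes [b]
    the central binomial coefficient, so [b' <= b] and the factor [b ^+ 2] cancels. *)
Lemma pair_count (lam : R) ps m : 0 <= lam -> pair_system ps ->
  (forall p, p \in ps -> skew_pair J A p /\ lam <= p.2) ->
  size ps = m.+1.*2 ->
  4 * lam ^+ 2 * m.+1%:R ^+ 2 <= gamma * m.+1.*2%:R `^ s + delta.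
Proof.
move=> lam0 ps_sys skew szps.
pose X := dicke W ps m.+1; pose N : R := m.+1.*2%:R `^ s.
pose b : R := 'C(m.+1.*2, m.+1)%:R.
have b0 : 0 < b.
  by rewrite ltr0n bin_gt0 -addnn leq_addr.
have XX : inner X X = b%:C.
  by rewrite /X dicke_norm // szps -(rmorph_nat (real_complex R)).
have up : `|dicke_delta W ps m.+1| ^+ 2 <= ((gamma * N + delta) * b)%:C.
  rewrite -Delta_dicke //; last by move=> p /skew[].
  apply: le_trans (Delta_bound (finite_particle_dicke ps m.+1)
    (number_pow_dicke s ps m.+1)) _.
  rewrite innerDr !innerZr -/X XX -/N !rmorphM rmorphD rmorphM /=.
  by rewrite mulrDl mulrA.
have low : (2 * lam * (m.+1%:R * b))%:C <=
    inner (dicke W ps m) (dicke_delta W ps m.+1).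
  have := @dicke_pairing _ _ _ _ W J_conj lam ps m ps_sys.
  move=> /(_ (fun p pps => (skew p pps).2)); rewrite szps => h.
  apply: le_trans h.
  rewrite natrM -/b le_eqVlt; apply/orP; left; apply/eqP.
  by rewrite [LHS]rmorphM; congr (_ * _); rewrite /b rmorphM /= !rmorph_nat.
pose b' : R := 'C(m.+1.*2, m)%:R.
have b'b : b' <= b.
  rewrite ler_nat -(leq_pmul2l (ltn0Sn m)) mul_bin_left.
  by rewrite leq_mul2r ltn_subRL addnn ltn_double ltnSn orbT.
have := cauchy_schwarz (dicke W ps m) (dicke_delta W ps m.+1).
rewrite -[`|dicke W ps m| ^+ 2]inner_norm dicke_norm // szps => cs.
have cs' : (2 * lam * (m.+1%:R * b)) ^+ 2 <= b' * ((gamma * N + delta) * b).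
  rewrite -lecR rmorphXn /=.
  have low0 : 0 <= (2 * lam * (m.+1%:R * b))%:C :> R[i].
    by rewrite ler0c !mulr_ge0 // ltW.
  apply: (@le_trans _ _ (`|inner (dicke W ps m) (dicke_delta W ps m.+1)| ^+ 2)).
    rewrite ler_sqr ?nnegrE //; apply: (le_trans low).
    by rewrite ger0_norm // (le_trans low0).
  apply: (le_trans cs); rewrite rmorphM /= rmorph_nat.
  by rewrite ler_wpM2l.
(* This sign permits replacing [b'] by [b]; it holds because the bracket times [b] dominates a
   squared norm. *)
have gN : 0 <= gamma * N + delta.
  rewrite -(pmulr_lge0 _ b0) -ler0c; apply: le_trans up.
  by rewrite exprn_ge0.
rewrite -(ler_pM2r (exprn_gt0 2 b0)).
apply: (@le_trans _ _ (b' * ((gamma * N + delta) * b))).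
  by apply: le_trans cs'; rewrite le_eqVlt; apply/orP; left; apply/eqP; ring.
rewrite mulrC -mulrA expr2 ler_wpM2l // ler_wpM2l //; exact: ltW.
Qed.

End PairCount.

(** * Pairs of singular vectors *)

Section EigenPairs.
Variables (R : realType) (L : hilbertType R) (J : L -> L).
Hypothesis J_conj : conjugation J.
Variable A : {linear L -> L}.
Hypothesis A_skew : is_transpose J A (fun f => - A f).
Implicit Types (f g u : L) (l : R) (p q : L * L * R).

Let JK : involutive J := conjugationK J_conj.

(* As J A is antilinear with (J A)^2 = - A^* A, this is the eigenspace of
   A^* A for l^2. *)
Definition skew_eigen l f : Prop := J (A (J (A f))) = - (l ^+ 2)%:C *: f.

Lemma inner_ext f g : (forall h, inner f h = inner g h) -> f = g.
Proof.
move=> fg; apply/eqP; rewrite -subr_eq0 -inner_eq0 innerBl fg.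
by rewrite subrr.
Qed.

Lemma skew_eigen_adjoint (As : L -> L) l f : is_adjoint A As ->
  As (A f) = (l ^+ 2)%:C *: f -> skew_eigen l f.
Proof.
move=> adj eig; rewrite /skew_eigen scaleNr -eig; apply: inner_ext => h.
rewrite innerNl adj innerC (inner_skew J_conj A_skew) rmorphN /=.
by rewrite -[(inner _ _)^*%R]innerC (inner_conjugation J_conj).
Qed.

Lemma skew_eigenD l f g : skew_eigen l f -> skew_eigen l g ->
  skew_eigen l (f + g).
Proof.
rewrite /skew_eigen => hf hg.
by rewrite !(linearD A, conjugationD J_conj) hf hg scalerDr.
Qed.

Lemma skew_eigenZ l (c : R[i]) f : skew_eigen l f -> skew_eigen l (c *: f).
Proof.
rewrite /skew_eigen => hf; rewrite linearZ (conjugationZ J_conj) linearZ.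
by rewrite (conjugationZ J_conj) conjCK hf !scalerA mulrC.
Qed.

Lemma skew_eigen0 l : skew_eigen l 0.
Proof. by rewrite /skew_eigen !(linear0 A, conjugation0 J_conj) scaler0. Qed.

Lemma skew_pair_eigen p : skew_pair J A p ->
  skew_eigen p.2 p.1.1 /\ skew_eigen p.2 p.1.2.
Proof.
move=> [Jf Jg].
have conjp : (p.2%:C)^*%R = p.2%:C by exact: conjc_real.
split; rewrite /skew_eigen.
  by rewrite Jf linearZ (conjugationZ J_conj) Jg conjp scalerA mulrN -expr2 -rmorphXn.
rewrite Jg linearZ (conjugationZ J_conj) Jf rmorphN /= conjp scalerA mulNr -expr2.
by rewrite -rmorphXn.
Qed.

(** Two applications of skewness show that (J A)^2 is symmetric; its eigenvalues - l^2 and - l'^2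
    are real, and they differ because l and l' are positive. *)
Lemma inner_skew_eigen l l' f g : 0 < l -> 0 < l' -> l != l' ->
  skew_eigen l f -> skew_eigen l' g -> inner f g = 0.
Proof.
move=> l0 l'0 ll' hf hg.
have h : inner (J (A (J (A f)))) g = inner f (J (A (J (A g)))).
  rewrite innerC (inner_skew J_conj A_skew) rmorphN /= -[(inner _ _)^*%R]innerC.
  rewrite [RHS](inner_skew J_conj A_skew); congr (- _).
move: h; rewrite hf hg innerZl innerZr rmorphN /=.
have -> : ((l ^+ 2)%:C)^*%R = (l ^+ 2)%:C by exact: conjc_real.
move=> /eqP; rewrite -subr_eq0 -mulrBl mulf_eq0 => /orP[|/eqP //].
rewrite opprK addrC -rmorphB /= -(rmorph0 (real_complex R)).
rewrite (inj_eq (@complexI R)) subr_sqr mulf_eq0 subr_eq0 eq_sym (negPf ll') /=.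
by rewrite gt_eqF // addr_gt0.
Qed.

Lemma inner_skew_diag f : inner f (J (A f)) = 0.
Proof.
have /eqP := inner_skew J_conj A_skew f f.
by rewrite -addr_eq0 -mulr2n mulrn_eq0 /= => /eqP.
Qed.

(** The partner of f is g = J A f / l. Skewness makes it orthogonal to f, and (J A)^2 f = - l^2 f
    gives both its norm and J A g = - l f. *)
Lemma exists_skew_pair l f : 0 < l -> inner f f = 1 -> skew_eigen l f ->
  let p := (f, l^-1%:C *: J (A f), l) in
  [/\ inner p.1.2 p.1.2 = 1, inner p.1.1 p.1.2 = 0 & skew_pair J A p].
Proof.
move=> l0 ff hf /=.
have l0' : l%:C != 0 :> R[i].
  by rewrite -(rmorph0 (real_complex R)) (inj_eq (@complexI R)) gt_eqF.
have conjl : (l^-1%:C)^*%R = l^-1%:C by exact: conjc_real.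
have lV : l^-1%:C = l%:C^-1 :> R[i] by exact: fmorphV.
split.
- rewrite innerZl innerZr conjl (inner_skew J_conj A_skew) hf innerZr ff lV.
  rewrite mulr1 opprK rmorphXn /= mulrA -invfM -expr2 mulVf //.
  by rewrite expf_neq0.
- by rewrite innerZr inner_skew_diag mulr0.
split => /=; first by rewrite scalerA lV divff // scale1r.
rewrite linearZ (conjugationZ J_conj) conjl hf scalerA mulrN rmorphXn /= lV.
by rewrite expr2 mulKf.
Qed.

Lemma pair_system_cat ps qs : pair_system ps -> pair_system qs ->
  (forall p q, p \in ps -> q \in qs -> orth_pair p.1.1 q /\ orth_pair p.1.2 q) ->
  pair_system (ps ++ qs).
Proof.
elim: ps => [//|p ps IH] /= [ff gg fg orth ps_sys] qs_sys pq; split => //.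
  move=> q; rewrite mem_cat => /orP[/orth //|]; apply: pq; exact: mem_head.
by apply: IH => // p' q p'ps; apply: pq; rewrite inE p'ps orbT.
Qed.

(** The conditions form a homogeneous linear system with fewer equations than unknowns. *)
Lemma exists_orthogonal_combination n (v : 'I_n -> L) (ws : seq L) :
  (size ws < n)%N ->
  exists2 c : 'I_n -> R[i], (exists i, c i != 0) &
    forall w, w \in ws -> inner w (\sum_(i < n) c i *: v i) = 0.
Proof.
move=> wsn.
pose M : 'M[R[i]]_(n, size ws) := \matrix_(i, j) inner (nth 0 ws j) (v i).
have : kermx M != 0.
  rewrite kermx_eq0 /row_free; apply: contraTneq wsn => <-.
  by rewrite -leqNgt rank_leq_col.
move=> /rowV0Pn[c /sub_kermxP cM c0]; exists (fun i => c 0 i).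
  by move/rV0Pn: c0.
move=> w wws; have iw : (index w ws < size ws)%N by rewrite index_mem.
have /matrixP/(_ 0 (Ordinal iw)) := cM.
rewrite !mxE => cw; rewrite inner_sumr -[RHS]cw; apply: eq_bigr => i _.
by rewrite innerZr mxE /= nth_index.
Qed.

(** Pairs are added one at a time: a unit f in the span of the [v i] is chosen orthogonal to the
    modes already taken, and its partner then is too. A new f exists while the 2 j modes taken are
    fewer than n, so an odd n still yields (n + 1) / 2 pairs. *)
Lemma exists_pair_system_eigen l n (v : 'I_n -> L) j : 0 < l ->
  lin_indep v -> (forall i, skew_eigen l (v i)) -> (j.*2 <= n.+1)%N ->
  exists ps, [/\ pair_system ps, size ps = j &
    forall p, p \in ps -> skew_pair J A p /\ p.2 = l].
Proof.
move=> l0 indep eig; elim: j => [_|j IH jn].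
  by exists [::].
have [|ps [ps_sys szps skew]] := IH.
  by apply: leq_trans jn; rewrite leq_double.
pose ws := [seq p.1.1 | p <- ps] ++ [seq p.1.2 | p <- ps].
have [|c [i0 ci0] orth] := @exists_orthogonal_combination n v ws.
  by rewrite size_cat !size_map szps addnn -ltnS -doubleS.
set f0 := \sum_(i < n) _ in orth.
have f00 : f0 != 0 by apply: contraNneq ci0 => /indep ->.
have eigf0 : skew_eigen l f0.
  rewrite /f0; elim/big_ind: _ => [|x y|i _]; [exact: skew_eigen0|exact: skew_eigenD|].
  exact: skew_eigenZ.
pose f := `|f0|^-1 *: f0.
have eigf : skew_eigen l f by exact: skew_eigenZ.
have ff : inner f f = 1.
  rewrite inner_norm normrZ normfV normr_id mulVf ?expr1n //.
  by rewrite normr_eq0.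
have [gg fg skewf] := exists_skew_pair l0 ff eigf.
exists ((f, l^-1%:C *: J (A f), l) :: ps); split => /=; last first.
- by move=> p; rewrite inE => /orP[/eqP -> //|/skew].
- by rewrite szps.
split => // q qps.
have [[Jq1 Jq2] ql] := skew _ qps.
have fq1 : inner f q.1.1 = 0.
  rewrite innerC innerZr orth ?mulr0 ?conjC0 // mem_cat; apply/orP; left.
  exact: map_f.
have fq2 : inner f q.1.2 = 0.
  rewrite innerC innerZr orth ?mulr0 ?conjC0 // mem_cat; apply/orP; right.
  exact: (map_f (fun p => p.1.2)).
(* The chosen pairs span a subspace invariant under J A, so by skewness orthogonality to them passes
   from f to J A f. *)
have Jf u : inner f (J (A u)) = 0 -> inner (l^-1%:C *: J (A f)) u = 0.
  by move=> h; rewrite innerZl innerC (inner_skew J_conj A_skew) h oppr0 conjC0 mulr0.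
split; split => //=; apply: Jf.
  by rewrite Jq1 innerZr fq2 mulr0.
by rewrite Jq2 innerZr fq1 mulr0.
Qed.

(** Each l supplies [uphalf (m l)] pairs, hence at least [m l] modes; eigenspaces for different l
    are orthogonal, so the lists can be concatenated. *)
Lemma exists_pair_system (X : seq R) (m : R -> nat) : uniq X ->
  (forall l, l \in X -> 0 < l /\ exists2 v : 'I_(m l) -> L, lin_indep v &
     forall i, skew_eigen l (v i)) ->
  exists ps, [/\ pair_system ps, (\sum_(l <- X) m l <= (size ps).*2)%N &
    forall p, p \in ps -> skew_pair J A p /\ p.2 \in X].
Proof.
elim: X => [|l X IH] /=; first by exists [::]; rewrite big_nil.
move=> /andP[lX uX] h.
have [||ps [ps_sys szps skew]] := IH; first exact: uX.
  by move=> l' l'X; apply: h; rewrite inE l'X orbT.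
have [l0 [v indep eig]] := h l (mem_head _ _).
have [|qs [qs_sys szqs skewq]] := @exists_pair_system_eigen l _ v (uphalf (m l)) l0 indep eig.
  by rewrite uphalfE halfK leq_subr.
exists (qs ++ ps); split.
- apply: pair_system_cat => // p q pqs qps.
  have [skp pl] := skewq _ pqs; have [skq qX] := skew _ qps.
  have [hp1 hp2] := skew_pair_eigen skp; have [hq1 hq2] := skew_pair_eigen skq.
  have q0 : 0 < q.2 by apply: (h _ _).1; rewrite inE qX orbT.
  have pq : p.2 != q.2 by rewrite pl; apply: contraNneq lX => ->.
  have p0 : 0 < p.2 by rewrite pl.
  by split; split; apply: inner_skew_eigen pq _ _.
- rewrite big_cons size_cat doubleD leq_add // szqs.
  by rewrite uphalf_half doubleD -[X in (X <= _)%N]odd_double_half leq_add2r -muln2 leq_pmulr.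
move=> p; rewrite mem_cat => /orP[/skewq[sk ->]|/skew[sk pX]]; split => //.
  exact: mem_head.
by rewrite inE pX orbT.
Qed.

End EigenPairs.

(** * Counting functions and power sums *)

Section RealEstimates.
Variable R : realType.
Implicit Types (x y lam r s p : R).

Lemma powR_exprn x n p : 0 <= x -> (x ^+ n) `^ p = (x `^ p) ^+ n.
Proof.
move=> x0; rewrite -(powR_mulrn n x0) -(powR_mulrn n (powR_ge0 x p)).
by rewrite -!powRrM mulrC.
Qed.

(** Since 2 - s = 2 / r, dividing by x^s leaves lam^2 x^(2 / r) <= B, and raising to the power r / 2
    gives the claim. As x >= 1 and s >= 0, x^s >= 1, which lets delta be absorbed in [B]. *)
Lemma power_count r s gamma delta lam x : 1 <= r -> s = 2 * (r - 1) / r ->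
  0 < lam -> 1 <= x ->
  4 * lam ^+ 2 * x ^+ 2 <= gamma * (2 * x) `^ s + delta ->
  x <= (`|gamma| * 2 `^ s + `|delta|) `^ (r / 2) * lam `^ (- r).
Proof.
move=> r1 sE lam0 x1; set B := `|gamma| * 2 `^ s + `|delta|.
have r0 : 0 < r by exact: lt_le_trans r1.
have x0 : 0 < x by exact: lt_le_trans x1.
have s0 : 0 <= s by rewrite sE !mulr_ge0 ?subr_ge0 ?invr_ge0 // ltW.
have B0 : 0 <= B by rewrite addr_ge0 // mulr_ge0 // powR_ge0.
have xs1 : 1 <= x `^ s by rewrite -(powRr0 x) ler_powR.
move=> h.
have hB : lam ^+ 2 * x ^+ 2 <= B * x `^ s.
  apply: (@le_trans _ _ (4 * lam ^+ 2 * x ^+ 2)).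
    rewrite -mulrA ler_peMl ?mulr_ge0 ?exprn_ge0 ?ltW //.
    by rewrite (ltr_nat R 1 4).
  apply: (le_trans h); rewrite powRM ?(ltW x0) // mulrA /B mulrDl lerD //.
    by rewrite ler_wpM2r ?powR_ge0 // ler_wpM2r ?powR_ge0 // ler_norm.
  by apply: (le_trans (ler_norm _)); rewrite ler_peMr.
have x2 : x ^+ 2 = x `^ (2 / r) * x `^ s.
  rewrite -powRD; last by rewrite (gt_eqF x0) implybT.
  rewrite -powR_mulrn ?ltW //; congr (_ `^ _).
  by rewrite sE; field; rewrite gt_eqF.
have {hB} : lam ^+ 2 * x `^ (2 / r) <= B.
  by move: hB; rewrite x2 mulrA ler_pM2r // powR_gt0.
move=> /(@ge0_ler_powR _ (r / 2)); rewrite !nnegrE.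
rewrite divr_ge0 ?(ltW r0) // B0 mulr_ge0 ?exprn_ge0 ?powR_ge0 ?(ltW lam0) //.
move=> /(_ isT isT isT).
rewrite powRM ?exprn_ge0 ?powR_ge0 ?(ltW lam0) // -powRrM.
rewrite -(powR_mulrn _ (ltW lam0)) -powRrM.
rewrite (_ : 2 / r * (r / 2) = 1); last by field; rewrite gt_eqF.
rewrite (_ : 2%:R * (r / 2) = r); last by field.
rewrite (powRr1 (ltW x0)) powRN => {}h.
by rewrite ler_pdivlMr ?powR_gt0 // mulrC.
Qed.

Definition dyadic (M : R) k : R := M * 2^-1 ^+ k.

Lemma dyadic_gt0 M k : 0 < M -> 0 < dyadic M k.
Proof. by move=> M0; rewrite mulr_gt0 // exprn_gt0. Qed.

Lemma dyadic_le M k : 0 < M -> dyadic M k <= M.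
Proof.
move=> M0; rewrite ler_piMr ?(ltW M0) // exprn_ile1 //.
by rewrite invf_le1 ?ler1n.
Qed.

Lemma dyadic_bracket M l : 0 < M -> 0 < l -> l <= M ->
  exists k, dyadic M k.+1 <= l <= dyadic M k.
Proof.
move=> M0 l0 lM.
have ex : exists k, dyadic M k.+1 <= l.
  have /andP[_ h] := Num.Theory.truncn_itv (ltW (divr_gt0 M0 l0)).
  set n := Num.truncn _ in h; exists n.
  rewrite /dyadic exprVn ler_pdivrMr ?exprn_gt0 // mulrC -ler_pdivrMr //.
  apply: (le_trans (ltW h)); rewrite -natrX ler_nat.
  exact: ltnW (ltn_expl _ _).
(* For the least index k, the threshold [dyadic M k] still exceeds [l] if k is positive; at k = 0
   the upper bound is [l <= M]. *)
case: (ex_minnP ex) => [[|k] hk mink].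
  by exists 0%N; rewrite hk /dyadic expr0 mulr1.
exists k.+1; rewrite hk /= leNgt; apply/negP => /ltW /mink.
by rewrite ltnn.
Qed.

(** The term of the shell containing l is already at least l^p. In every term l enters only through
    a threshold test, so summing over l produces counting functions. *)
Lemma dyadic_dominate M (X : seq R) p : 0 < M -> 0 <= p ->
  (forall l, l \in X -> 0 < l /\ l <= M) ->
  exists K, forall l, l \in X ->
    l `^ p <= \sum_(0 <= k < K) dyadic M k `^ p * (dyadic M k.+1 <= l)%R%:R.
Proof.
move=> M0 p0; elim: X => [|l X IH] h; first by exists 0%N.
have [|K hK] := IH; first by move=> l' l'X; apply: h; rewrite inE l'X orbT.
have [l0 lM] := h l (mem_head _ _).
have [k /andP[kl lk]] := dyadic_bracket M0 l0 lM.
have mono K1 K2 y : (K1 <= K2)%N ->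
  \sum_(0 <= k < K1) dyadic M k `^ p * (dyadic M k.+1 <= y)%R%:R <=
  \sum_(0 <= k < K2) dyadic M k `^ p * (dyadic M k.+1 <= y)%R%:R.
  move=> K12; rewrite (big_cat_nat (leq0n K1) K12) /= lerDl sumr_ge0 // => i _.
  by rewrite mulr_ge0 ?powR_ge0.
exists (maxn K k.+1) => l'; rewrite inE => /orP[/eqP ->|/hK l'X]; last first.
  by apply: (le_trans l'X); apply: mono; exact: leq_maxl.
apply: le_trans (mono k.+1 _ _ (leq_maxr _ _)).
rewrite big_nat_recr //= kl mulr1.
apply: (@le_trans _ _ (dyadic M k `^ p)).
  by rewrite ge0_ler_powR // nnegrE ltW // dyadic_gt0.
by rewrite lerDr sumr_ge0 // => i _; rewrite mulr_ge0 ?powR_ge0.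
Qed.

Lemma dyadic_geometric M p r k : 0 < M ->
  dyadic M k `^ p * dyadic M k.+1 `^ (- r) =
  M `^ p * M `^ (- r) * 2^-1 `^ (- r) * (2^-1 `^ (p - r)) ^+ k.
Proof.
move=> M0; have h0 : (0 : R) <= 2^-1 by rewrite invr_ge0.
rewrite /dyadic !powRM ?exprn_ge0 ?(ltW M0) // !powR_exprn // exprS.
rewrite powRD ?exprMn; last by rewrite invr_eq0 pnatr_eq0 implybT.
by ring.
Qed.

(* Summation over the shells ]M 2^(-k-1), M 2^(-k)] leaves a geometric series of
   ratio 2^(-(p - r)). *)
Lemma dyadic_sum_bound M C r p : 0 < M -> 0 <= C -> 0 <= r -> r < p ->
  exists B, forall (X : seq R) (m : R -> nat),
    (forall l, l \in X -> 0 < l /\ ((0 < m l)%N -> l <= M)) ->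
    (forall lam, 0 < lam -> lam <= M ->
      (\sum_(l <- X | (lam <= l)%R) m l)%:R <= C * lam `^ (- r)) ->
    \sum_(l <- X) (m l)%:R * l `^ p <= B.
Proof.
move=> M0 C0 r0 rp; have p0 : 0 <= p by rewrite ltW // (le_lt_trans r0).
pose a := C * (M `^ p * M `^ (- r) * 2^-1 `^ (- r)).
pose x : R := 2^-1 `^ (p - r).
have h0 : (0 : R) < 2^-1 by rewrite invr_gt0.
have a0 : 0 <= a by rewrite !mulr_ge0 ?powR_ge0.
have x0 : 0 < x by rewrite powR_gt0.
have x1 : `|x| < 1.
  rewrite ger0_norm ?ltW // -[ltRHS](congr1 (fun f => f (p - r)) (powR1 R)).
  rewrite /x gt0_ltr_powR ?subr_gt0 ?nnegrE ?ltW // ?invf_lt1 ?ltr1n //.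
exists (a / (1 - x)) => X m hX count.
(* Values of multiplicity 0 contribute nothing; they are dropped because [l <= M] is given only for
   positive multiplicity. *)
pose Y := [seq l <- X | (0 < m l)%N].
have [K hK] : exists K, forall l, l \in Y ->
    l `^ p <= \sum_(0 <= k < K) dyadic M k `^ p * (dyadic M k.+1 <= l)%R%:R.
  apply: dyadic_dominate => // l; rewrite mem_filter => /andP[ml /hX[l0 lM]].
  by split=> //; exact: lM.
apply: (le_trans _ (geometric_le_lim K a0 x0 x1)).
apply: (@le_trans _ _ (\sum_(l <- X) (m l)%:R *
    \sum_(0 <= k < K) dyadic M k `^ p * (dyadic M k.+1 <= l)%R%:R)).
  rewrite big_seq [leRHS]big_seq; apply: ler_sum => l lX.
  have [->|ml] := posnP (m l); first by rewrite !mul0r.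
  by rewrite ler_wpM2l // hK // mem_filter ml.
under eq_bigr do rewrite mulr_sumr.
(* For fixed k, the sum over l counts with multiplicity the values above [dyadic M k.+1]. *)
rewrite exchange_big /=; apply: ler_sum => k _.
apply: (@le_trans _ _ (dyadic M k `^ p * (C * dyadic M k.+1 `^ (- r)))).
  have := count _ (dyadic_gt0 k.+1 M0) (dyadic_le k.+1 M0).
  move=> /(ler_wpM2l (powR_ge0 (dyadic M k) p)); apply: le_trans.
  rewrite le_eqVlt; apply/orP; left; apply/eqP.
  rewrite natr_sum mulr_sumr [RHS]big_mkcond /=; apply: eq_bigr => l _.
  by case: ifP => _; rewrite ?mulr1 ?mulr0 // mulrC.
by rewrite mulrCA dyadic_geometric // /a -/x mulrA.
Qed.

End RealEstimates.

(** A finite supremum of natural numbers is a maximum. *)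
Lemma vdim_attained (K : fieldType) (V : lmodType K) (R : realType) (E : set V) :
  (vdim R E < +oo)%E -> exists n : nat, vdim R E = n%:R%:E /\
    exists2 v : 'I_n -> V, lin_indep v & forall i, E (v i).
Proof.
move=> Efin.
pose P n := `[< exists2 v : 'I_n -> V, lin_indep v & forall i, E (v i) >].
(* The empty family keeps the supremum away from -oo. *)
have P0 : P 0%N.
  by apply/asboolP; exists (fun=> 0) => [c _ []|[]].
have PE n : P n -> (n%:R%:E <= vdim R E)%E.
  by move=> /asboolP Pn; apply: ereal_sup_ubound; exists n.
have [x Ex] : exists x : R, vdim R E = x%:E.
  case: (vdim R E) Efin (PE _ P0) => [x _ _|//|_]; first by exists x.
  by rewrite leeNy_eq.
have ubP n : P n -> (n <= Num.truncn x)%N.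
  move=> /PE; rewrite Ex lee_fin => nx.
  by rewrite truncn_ge_nat // (le_trans _ nx).
have exP : exists n, P n by exists 0%N.
have [n Pn maxn] := ex_maxnP exP ubP.
exists n; split; last by apply/asboolP.
apply/eqP; rewrite eq_le PE // andbT.
apply: ge_ereal_sup => _ [j Pj <-].
by rewrite lee_fin ler_nat maxn //; apply/asboolP.
Qed.

(** Prepares for [pair_count], which takes a positive even number of pairs: the head of an odd list
    is discarded. *)
Lemma exists_even_pair_system (R : realType) (L : hilbertType R)
    (ps : seq (L * L * R)) : pair_system ps -> (1 < size ps)%N ->
  exists qs m, [/\ pair_system qs, {subset qs <= ps}, size qs = m.+1.*2 &
    (size ps <= m.+1.*2.+1)%N].
Proof.
have even (qs : seq (L * L * R)) : ~~ odd (size qs) -> (0 < size qs)%N ->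
    size qs = ((size qs)./2.-1.+1).*2.
  move=> ev qs0; rewrite prednK; last by case: (size qs) qs0 ev => [|[]].
  by rewrite -[LHS]odd_double_half (negPf ev).
case: ps => [//|p ps] sys sz; have [psodd|ev] := boolP (odd (size (p :: ps))).
  exists ps, (size ps)./2.-1; rewrite -even //; split=> //; first by case: sys.
  by move=> q qps; rewrite inE qps orbT.
exists (p :: ps), (size (p :: ps))./2.-1.
by rewrite -even //; split.
Qed.

(** * From the pair count to the Schatten class *)

Theorem theorem4p5 (R : realType) (L : hilbertType R)
  (L_sep : separable_space L) (L_inf : infinite_dimensional L)
  (J : L -> L) (J_conj : conjugation J)
  (e : nat -> L) (e_cons : complete_orthonormal e)
  (F : hilbertType R) (W : fock_rep J F)
  (A : {linear L -> L}) (A_B2 : schatten_skew J 2 A)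
  (r s : R) (r_ge1 : 1 <= r) (r_le2 : r <= 2) (s_def : s = 2 * (r - 1) / r)
  (gamma delta : R)
  (Delta_bound : forall Phi Psi : F,
     finite_particle W Phi -> number_pow W e s Phi Psi ->
     `|Delta W e A Phi| ^+ 2 <=
       inner Phi (gamma%:C *: Psi + delta%:C *: Phi)) :
  forall eps : R, 0 < eps -> schatten_skew J (r + eps) A.
Proof.
move=> eps eps0; case: A_B2 => -[A_cpt [As adj sum2]] A_skew.
split=> //; split=> //; exists As => //.
have [k k0 A_bdd] := compact_operator_bounded A_cpt.
pose C := (`|gamma| * 2 `^ s + `|delta|) `^ (r / 2).
have C0 : 0 <= C by exact: powR_ge0.
(* The multiplicities add up to at most twice the number of pairs, and parity costs at most one
   pair. With 2 (j + 1) pairs left and j + 1 <= C lam^(- r), the total is at most 2 (2 (j + 1) + 1)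
   = 4 (j + 1) + 2. *)
have count (X : seq R) (m : R -> nat) lam : uniq X -> 0 < lam ->
    (forall l, l \in X -> lam <= l /\ exists2 v : 'I_(m l) -> L,
       lin_indep v & forall i, As (A (v i)) = (l ^+ 2)%:C *: v i) ->
    (\sum_(l <- X) m l)%:R <= 4 * C * lam `^ (- r) + 2.
  move=> uX lam0 hX.
  have [|ps [sys sz skew]] := exists_pair_system J_conj A_skew uX (m := m).
    move=> l /hX[laml [v indep eig]]; split; first exact: lt_le_trans laml.
    by exists v => // i; exact: (skew_eigen_adjoint J_conj A_skew adj).
  have [sz1|/(exists_even_pair_system sys)[qs [j [qsys qps szq szp]]]] := leqP (size ps) 1.
    apply: (@le_trans _ _ 2); last by rewrite lerDr !mulr_ge0 ?powR_ge0.
    by rewrite (ler_nat _ _ 2) (leq_trans sz) // -[2%N]/(1.*2)%N leq_double.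
  have := pair_count J_conj e_cons k0 A_bdd A_skew Delta_bound (ltW lam0) qsys _ szq.
  have -> : j.+1.*2%:R = 2 * j.+1%:R :> R by rewrite -muln2 natrM mulrC.
  move=> h; have {h} := power_count r_ge1 s_def lam0 _ (h _); rewrite -/C.
  rewrite (ler_nat R 1 j.+1) => h.
  have {}h : j.+1%:R <= C * lam `^ (- r).
    apply: h => // p /qps/skew[skp pX]; split => //.
    by have [] := hX _ pX.
  apply: (@le_trans _ _ (4 * j.+1%:R + 2)); last first.
    by rewrite -mulrA lerD2r ler_wpM2l.
  have -> : 4 * j.+1%:R + 2 = (j.+1.*2.+1).*2%:R :> R.
    by rewrite -!muln2; ring.
  by rewrite ler_nat (leq_trans sz) // leq_double.
(* The Hilbert-Schmidt sum bounds each of its terms, which makes the multiplicities finite and the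
   singular values bounded. *)
have [S [S0 hS]] : exists S : R, 0 <= S /\ forall l, 0 < l ->
    (singular_mult A As l * (l `^ 2)%:E <= S%:E)%E.
  move: sum2; set T := esum _ _ => Tfin.
  have T0 : (0 <= T)%E.
    by apply: esum_ge; exists set0; rewrite ?fsbig_set0 //; split.
  exists (fine T); split; first exact: fine_ge0.
  move=> l l0; rewrite fineK; last by rewrite ge0_fin_numE.
  apply: esum_ge; exists [set l]; last by rewrite fsbig_set1.
  by split; [exact: finite_set1|move=> _ ->].
have mult_fin l : 0 < l -> exists n : nat,
    singular_mult A As l = n%:R%:E /\ exists2 v : 'I_n -> L,
      lin_indep v & forall i, As (A (v i)) = (l ^+ 2)%:C *: v i.
  move=> l0; apply: vdim_attained; rewrite ltey; apply/eqP => oo.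
  by have := hS l l0; rewrite /singular_mult oo gt0_mulye ?lte_fin ?powR_gt0.
have [m mP] : exists m : R -> nat, forall l, 0 < l ->
    singular_mult A As l = (m l)%:R%:E /\ exists2 v : 'I_(m l) -> L,
      lin_indep v & forall i, As (A (v i)) = (l ^+ 2)%:C *: v i.
  have : forall l, exists n : nat, 0 < l ->
    singular_mult A As l = n%:R%:E /\ exists2 v : 'I_n -> L,
      lin_indep v & forall i, As (A (v i)) = (l ^+ 2)%:C *: v i.
    move=> l; have [/mult_fin[n hn]|l0] := ltP 0 l; first by exists n.
    by exists 0%N.
  by move=> /choice[m mP]; exists m.
(* A singular value l has l^2 <= S; l > S + 1 would give l <= l^2 <= S. *)
have [M M0 mM] : exists2 M, 0 < M & forall l, 0 < l -> (0 < m l)%N -> l <= M.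
  exists (S + 1); first by rewrite ltr_wpDl.
  move=> l l0 ml; have := hS l l0; have [-> _] := mP l l0.
  rewrite -EFinM lee_fin powR_mulrn ?(ltW l0) // => mlS.
  have {mlS} lS : l ^+ 2 <= S.
    by apply: le_trans mlS; rewrite ler_peMl ?exprn_ge0 ?(ltW l0) // ler1n.
  rewrite leNgt; apply/negP => Sl.
  have l1 : 1 <= l by apply: le_trans (ltW Sl); rewrite lerDr.
  have : l <= S by apply: le_trans lS; rewrite expr2 ler_peMr // ltW.
  by apply/negP; rewrite -ltNge; apply: lt_trans Sl; rewrite ltrDl.
have r0 : 0 <= r by exact: le_trans r_ge1.
(* For lam <= M the constant 2 of [count] is at most 2 M^r lam^(- r), so the count is bounded by a
   pure power of lam. *)
have C'0 : 0 <= 4 * C + 2 * M `^ r by rewrite addr_ge0 // mulr_ge0 // powR_ge0.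
have rp : r < r + eps by rewrite ltrDl.
have [B hB] := dyadic_sum_bound M0 C'0 r0 rp.
apply: (@le_lt_trans _ _ B%:E); last exact: ltry.
(* The sum is a supremum over finite sets X, and [B] does not depend on X. *)
apply: ge_ereal_sup => _ [X [finX X0] <-].
rewrite fsbig_finite // big_seq.
rewrite (eq_bigr (fun l => ((m l)%:R * l `^ (r + eps))%:E)); last first.
  move=> l; rewrite in_fset_set // inE => /X0 /mP[-> _].
  by rewrite EFinM.
rewrite -big_seq sumEFin lee_fin; apply: hB.
  move=> l; rewrite in_fset_set // inE => /X0 l0; split => //.
  exact: mM.
move=> lam lam0 lamM; rewrite -big_filter.
have := count [seq l <- finmap.enum_fset (fset_set X) | (lam <= l)%R] m lam.
rewrite filter_uniq ?finmap.fset_uniq // => /(_ isT lam0) h.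
apply: (le_trans (h _)).
  move=> l; rewrite mem_filter => /andP[laml]; rewrite in_fset_set // inE => /X0.
  by move=> /mP[_].
rewrite [leRHS]mulrDl lerD2l -mulrA ler_peMr // powRN.
rewrite ler_pdivlMr ?powR_gt0 // mul1r.
by rewrite ge0_ler_powR // nnegrE ltW.
Qed.
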